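(* Let $\mathcal{T}$ be a mesh of a bounded domain $\Omega\subset\mathbb{R}^d$ ($d=2,3$) with face set $\mathcal{E}$, together with cell centres $(x_K)_{K\in\mathcal{T}}$ and boundary face centres $(x_e)_{e\in\mathcal{E}_0}$ satisfying the admissibility conditions given in the context, and let $f\in L^2(\Omega)$. Let $\mathrm{div}_h$, $\mathcal{F}_h$, $\pi_2$ and $d_e$ be the finite volume objects defined in the context, let $\Delta_h=\mathrm{div}_h\circ\mathcal{F}_h:\mathbb{R}^{\#\mathcal{T}}\to\mathbb{R}^{\#\mathcal{T}}$ and $P_h(u_h)=-\Delta_h u_h-\pi_2 f$ (discrete differential embedding of $P(u)=-\Delta u-f$), and let $\mathcal{L}_h:\mathbb{R}^{\#\mathcal{T}}\to\mathbb{R}$, $$\mathcal{L}_h(u_h)=\frac12\sum_{e\in\mathcal{E}}(\mathcal{F}_e u_h)^2\,|e|\,d_e-\sum_{K\in\mathcal{T}}f_K\,u_K\,|K|,$$ be the discrete variational embedding of $\mathcal{L}(u)=\int_\Omega\left(\frac12|\nabla u|^2-fu\right)dx$. Then these discrete variational and differential embeddings of the Poisson problem are coherent. Precisely, the discrete differential formulation (i) find $u_h\in\mathbb{R}^{\#\mathcal{T}}$ such that $P_h(u_h)=-\Delta_h u_h-\pi_2 f=0$ and the discrete variational formulation (ii) find $u_h\in\mathbb{R}^{\#\mathcal{T}}$ such that $D\mathcal{L}_h(u_h)(v_h)=0$ for all $v_h\in\mathbb{R}^{\#\mathcal{T}}$ have the same solutions.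
   Context: Setting: the Poisson problem $-\Delta u=f$ in $\Omega$ with $u=0$ on $\partial\Omega$. Mesh. A cell is a non-empty open polygonal/polyhedral subset of $\mathbb{R}^d$. A mesh $\mathcal{T}$ of $\Omega$ is a (finite) collection of cells with $\bigcup_{K\in\mathcal{T}}\overline{K}=\overline{\Omega}$ and, for $K_1,K_2\in\mathcal{T}$, either $K_1\cap K_2=\emptyset$ or $K_1=K_2$. The boundary faces $\mathcal{E}_0$ are the faces (edges if $d=2$) $e$ of cells $K\in\mathcal{T}$ with $e\subset\partial\Omega$; they satisfy $\partial\Omega=\bigcup_{e\in\mathcal{E}_0}e$, and for each $e\in\mathcal{E}_0$ there is a unique $K\in\mathcal{T}$ with $e\subset\overline{K}\cap\partial\Omega$, written $e=K|\partial\Omega$. The internal faces $\mathcal{E}_i$ are the sets $e=\overline{K_1}\cap\overline{K_2}$, $K_1\ne K_2$ in $\mathcal{T}$, with non-zero $(d-1)$-dimensional measure; the pair $K_1,K_2$ is unique and one writes $e=K_1|K_2$. The face set is $\mathcal{E}=\mathcal{E}_0\cup\mathcal{E}_i$; it satisfies $\bigcup_{e\in\mathcal{E}}e=\bigcup_{K\in\mathcal{T}}\partial K$, and two distinct faces overlap in a set that is empty or of zero $(d-1)$-dimensional measure. Faces are flat: for $e\in\mathcal{E}$ with $e\subset\partial K$, $\mathbf{n}_{K,e}$ is the unit normal to $e$ pointing outward of $K$; each face $e$ is also given an intrinsic orientation by choosing one of its two unit normals $\mathbf{n}_e$, so $\mathbf{n}_e=\pm\mathbf{n}_{K,e}$.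 Here $|K|$, $|e|$, $|xy|$ denote respectively the $d$-dimensional measure of $K$, the $(d-1)$-dimensional measure of $e$, and the distance between points $x$ and $y$; $\#E$ is the cardinality of a set $E$. Admissibility conditions: $x_K\in K$ for all $K\in\mathcal{T}$; $x_e\in e$ for all $e\in\mathcal{E}_0$; for all $e=K_1|K_2\in\mathcal{E}_i$, $[x_{K_1},x_{K_2}]\perp e$; for all $e=K|\partial\Omega\in\mathcal{E}_0$, $[x_e,x_K]\perp e$. Distances: $d_e=|x_{K_1}x_{K_2}|$ if $e=K_1|K_2\in\mathcal{E}_i$ and $d_e=|x_Kx_e|$ if $e=K|\partial\Omega\in\mathcal{E}_0$. Projection: $\pi_2:L^2(\Omega)\to\mathbb{R}^{\#\mathcal{T}}$, $\pi_2 f=(f_K)_{K\in\mathcal{T}}$ with $f_K=\frac1{|K|}\int_K f\,dx$. Finite volume divergence: $\mathrm{div}_h:\mathbb{R}^{\#\mathcal{E}}\to\mathbb{R}^{\#\mathcal{T}}$, $\mathrm{div}_h\,p=(\mathrm{div}_K\,p)_{K\in\mathcal{T}}$ for $p=(p_e)_{e\in\mathcal{E}}$, where $$\mathrm{div}_K\,p=\frac1{|K|}\sum_{e\in\mathcal{E},\,e\subset\partial K}p_e\,|e|\,\mathbf{n}_e\cdot\mathbf{n}_{K,e}.$$ Discrete flux operator: $\mathcal{F}_h:\mathbb{R}^{\#\mathcal{T}}\to\mathbb{R}^{\#\mathcal{E}}$, $u_h=(u_K)_{K\in\mathcal{T}}\mapsto(\mathcal{F}_eu_h)_{e\in\mathcal{E}}$,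 with $$\mathcal{F}_eu_h=\frac{u_{K_2}-u_{K_1}}{d_e}\,\mathbf{n}_{K_1,e}\cdot\mathbf{n}_e\ \text{ if } e=K_1|K_2\in\mathcal{E}_i,\qquad \mathcal{F}_eu_h=-\frac{u_K}{d_e}\,\mathbf{n}_{K,e}\cdot\mathbf{n}_e\ \text{ if } e=K|\partial\Omega\in\mathcal{E}_0.$$ The differential is $D\mathcal{L}_h(u)(v)=\lim_{\epsilon\to0}\frac{\mathcal{L}_h(u+\epsilon v)-\mathcal{L}_h(u)}{\epsilon}$. Coherence: a discrete differential embedding $P_h$ (a discretisation of the Euler-Lagrange operator $P$) and a discrete variational embedding $\mathcal{L}_h$ (a discretisation of the Lagrangian functional $\mathcal{L}$) are called coherent if the discrete differential formulation $P_h(u_h)=0$ and the discrete variational formulation (discrete least action principle) $D\mathcal{L}_h(u_h)(v_h)=0$ for all discrete variations $v_h$ are equivalent, i.e. have the same solutions. *)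

(* Defs.v *)
From HB Require Import structures.
From mathcomp Require Import all_boot all_order all_algebra.
From mathcomp Require Import all_classical all_reals all_analysis.
From mathcomp Require Import measurable_realfun.
Set Implicit Arguments.
Unset Strict Implicit.
Unset Printing Implicit Defensive.
Import Order.TTheory GRing.Theory Num.Theory.
Import numFieldNormedType.Exports.
Local Open Scope classical_set_scope.
Local Open Scope ring_scope.

(* 'rV[R]_n with its Borel sigma-algebra. *)
Definition borel (R : realType) (n : nat) :=
  g_sigma_algebraType (@open 'rV[R]_n).

Definition consrV (R : realType) (n : nat) (p : measurableTypeR R * borel R n) :
  borel R n.+1 := row_mx (const_mx p.1 : 'rV[R]_1) (p.2 : 'rV[R]_n).

Lemma consrV0 (R : realType) n (p : measurableTypeR R * borel R n) :
  (consrV p : 'rV_n.+1) ord0 ord0 = p.1.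
Proof.
by rewrite /consrV mxE; case: splitP => // j _; rewrite ord1 mxE.
Qed.

Lemma consrVS (R : realType) n (p : measurableTypeR R * borel R n) (j : 'I_n) :
  (consrV p : 'rV_n.+1) ord0 (lift ord0 j) = (p.2 : 'rV_n) ord0 j.
Proof.
rewrite /consrV mxE; case: splitP => k /=; first by rewrite ord1.
by rewrite /bump /= !add1n => -[] /val_inj ->.
Qed.

Lemma measurable_consrV (R : realType) n : measurable_fun setT (@consrV R n).
Proof.
apply: (@measurability _ _ _ (borel R n.+1) setT (@consrV R n) (@open 'rV[R]_n.+1)) => // _ [U oU <-].
rewrite setTI.
pose B (q : 'rV[rat]_n.+1 * rat) : set 'rV[R]_n.+1 :=
  ball (map_mx ratr q.1 : 'rV[R]_n.+1) (ratr q.2 : R).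
have mB q : measurable (@consrV R n @^-1` B q).
  have [r0|r0] := ltP 0 (ratr q.2 : R); last first.
    have -> : B q = set0 by apply/seteqP; split => // x [+ _]; rewrite ltNge r0.
    by rewrite preimage_set0.
  have -> : @consrV R n @^-1` B q =
    (ball (ratr (q.1 ord0 ord0) : R) (ratr q.2) : set (measurableTypeR R)) `*`
    (ball (\row_j ratr (q.1 ord0 (lift ord0 j)) : 'rV[R]_n) (ratr q.2)
       : set 'rV[R]_n).
    apply/seteqP; split=> p /=.
      move=> [_ h]; split; first by have := h ord0 ord0; rewrite consrV0 mxE.
      split=> // i j; have := h ord0 (lift ord0 j).
      by rewrite consrVS !mxE (ord1 i).
    move=> [h0 [_ hS]]; split=> // i j; rewrite (ord1 i).
    case: (unliftP ord0 j) => [k ->|->].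
      by rewrite consrVS mxE; have := hS ord0 k; rewrite mxE.
    by rewrite consrV0 mxE.
  apply: measurableX; first by exact: measurable_ball.
  by apply: sub_sigma_algebra; exact: ball_open.
have -> : U = \bigcup_(q : 'rV[rat]_n.+1 * rat)
   (if `[< B q `<=` U >] then B q else set0).
  apply/seteqP; split=> [v Uv|v [q _]]; last by case: asboolP => // + Bv; exact.
  have /nbhs_ballP[e /= e0 veU] : nbhs v U by exact: open_nbhs_nbhs.
  have /rat_in_itvoo[r /itvP rE] : 0 < e / 2 by rewrite divr_gt0.
  have r0 : 0 < ratr r :> R by rewrite rE.
  have /choice[c cP] : forall j, exists c : rat, `|v ord0 j - ratr c| < ratr r.
    move=> j; have /rat_in_itvoo[c /itvP cE] : v ord0 j < v ord0 j + ratr r.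
      by rewrite ltrDl.
    by exists c; rewrite distrC ger0_norm ?subr_ge0 ?ltrBlDl ?cE.
  have Bv : B (\row_j c j, r) v.
    by split=> // i j; rewrite (ord1 i) !mxE; apply: ball_sym; exact: cP.
  exists (\row_j c j, r) => //; case: asboolP => // -[] w Bw; apply: veU.
  apply: (@le_ball _ _ _ (ratr r + ratr r)).
    by rewrite (splitr e) lerD// ltW// rE.
  by apply: ball_triangle Bw; exact: ball_sym.
rewrite preimage_bigcup; apply: countable_bigcupT_measurable => //.
by move=> q; case: ifP => _; [exact: mB|rewrite preimage_set0].
Qed.



Definition unconsrV (R : realType) (n : nat) (v : borel R n.+1) :
    measurableTypeR R * borel R n :=
  ((v : 'rV_n.+1) ord0 ord0, \row_j (v : 'rV_n.+1) ord0 (lift ord0 j)).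

Lemma consrVK (R : realType) n : cancel (@consrV R n) (@unconsrV R n).
Proof.
move=> p; rewrite /unconsrV consrV0 [RHS]surjective_pairing; congr pair.
by apply/rowP => j; rewrite mxE consrVS.
Qed.

Lemma continuous_tailrV (R : realType) n :
  continuous (fun v : 'rV[R]_n.+1 => \row_j v ord0 (lift ord0 j) : 'rV[R]_n).
Proof.
move=> v A /nbhs_ballP[e /= e0 eA]; apply/nbhs_ballP; exists e => // w [_ vw].
by apply: eA; split=> // i j; rewrite !mxE.
Qed.

Lemma measurable_unconsrV (R : realType) n :
  measurable_fun setT (@unconsrV R n).
Proof.
apply/measurable_fun_pairP; split.
  apply: (@measurability _ _ _ (measurableTypeR R) setT (fst \o @unconsrV R n) (@RGenOpens.G R)).
    exact: RGenOpens.measurableE.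
  move=> _ [_ [x [y ->]] <-]; rewrite setTI; apply: sub_sigma_algebra.
  apply: open_comp => [v _|]; first exact: coord_continuous.
  exact: interval_open.
apply: (@measurability _ _ _ (borel R n) setT (snd \o @unconsrV R n) (@open 'rV[R]_n)) => //.
move=> _ [U oU <-]; rewrite setTI; apply: sub_sigma_algebra.
apply: (open_comp _ oU) => v _; exact: continuous_tailrV.
Qed.

Section lebesgue_rV_step.
Context (R : realType) (n : nat).
Variable mu : {sigma_finite_measure set (borel R n) -> \bar R}.

Definition lebesgue_step : set (borel R n.+1) -> \bar R :=
  pushforward (lebesgue_measure \x mu)%E (@consrV R n).

HB.instance Definition _ := Measure.copy lebesgue_step
  (measure_function_pushforward__canonical__measure_function_Measure
    (lebesgue_measure \x mu)%E (@measurable_consrV R n)).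

Lemma lebesgue_step_sigma_finite : sigma_finite setT lebesgue_step.
Proof.
have /sigma_finiteP[F [UF ndF Foo]] := sigma_finiteT (@lebesgue_measure R).
have /sigma_finiteP[G [UG ndG Goo]] := sigma_finiteT mu.
exists (fun k => @unconsrV R n @^-1` (F k `*` G k)).
  rewrite -preimage_bigcup (_ : \bigcup_k _ = setT) ?preimage_setT//.
  apply/seteqP; split=> // -[x y] _.
  have [i _ Fx] : (\bigcup_i F i) x by rewrite -UF.
  have [j _ Gy] : (\bigcup_i G i) y by rewrite -UG.
  exists (maxn i j) => //; split.
    by move: Fx; exact/subsetPset/ndF/leq_maxl.
  by move: Gy; exact/subsetPset/ndG/leq_maxr.
move=> k; have [mF Fk] := Foo k; have [mG Gk] := Goo k; split.
  rewrite -[X in measurable X]setTI; apply: measurable_unconsrV => //.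
  exact: measurableX.
rewrite /lebesgue_step /pushforward -comp_preimage.
rewrite (_ : _ \o _ = id) ?preimage_id; last first.
  by rewrite funeqE; exact: consrVK.
by rewrite product_measure1E// lte_mul_pinfty// ge0_fin_numE.
Qed.

HB.instance Definition _ := Measure_isSigmaFinite.Build _ _ _ lebesgue_step
  lebesgue_step_sigma_finite.

End lebesgue_rV_step.

(* n-dimensional Lebesgue measure on the Borel sets, as an iterated product of the
   one-dimensional one; lebesgue_rV_box gives its values on boxes. *)
Fixpoint lebesgue_rV (R : realType) (n : nat) :
    {sigma_finite_measure set (borel R n) -> \bar R} :=
  match n with
  | 0 => @dirac _ (borel R 0) (0 : 'rV[R]_0) R
  | m.+1 => lebesgue_step (lebesgue_rV R m)
  end.

Lemma open_box (R : realType) (n : nat) (a b : 'I_n -> R) :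
  open [set v : 'rV[R]_n | forall j, a j < v ord0 j < b j].
Proof.
rewrite openE => v /= ab; 
have h j : \forall x \near v, a j < (x : 'rV_n) ord0 j < b j.
  apply: (@coord_continuous R 1 n ord0 j v [set x | a j < x < b j]).
  rewrite -set_itvoo; apply: open_nbhs_nbhs; split; first exact: interval_open.
  by rewrite set_itvoo; exact: ab.
have := @filter_forall _ _ _ (nbhs v) _ h.
exact.
Qed.

Lemma lebesgue_rV_box (R : realType) (n : nat) (a b : 'I_n -> R) :
  (forall j, a j <= b j) ->
  lebesgue_rV R n [set v : 'rV_n | forall j, a j < v ord0 j < b j] =
  (\prod_j (b j - a j))%:E.
Proof.
elim: n a b => [|n IH] a b ab.
  by rewrite big_ord0 /= diracE mem_set// => -[].
rewrite big_ord_recl /= /lebesgue_step /pushforward.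
rewrite (_ : _ @^-1` _ = (`]a ord0, b ord0[ : set (measurableTypeR R)) `*`
  ([set v : 'rV_n | forall j : 'I_n,
     a (lift ord0 j) < v ord0 j < b (lift ord0 j)])).
  rewrite product_measure1E//; last first.
    by apply: sub_sigma_algebra; exact: open_box.
  rewrite IH// EFinM; congr (_ * _)%E.
  have := lebesgue_measure_itv `]a ord0, b ord0[; rewrite /= lte_fin => ->.
  by case: ltgtP (ab ord0) => // -> _; rewrite subrr.
apply/seteqP; split=> p /=.
  move=> h; split; first by have := h ord0; rewrite consrV0 in_itv.
  by move=> j; have := h (lift ord0 j); rewrite consrVS.
move=> [/=]; rewrite in_itv/= => h0 hS j.
case: (unliftP ord0 j) => [k ->|->]; first by rewrite consrVS.
by rewrite consrV0.
Qed.

Section geometry.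
Context (R : realType) (d : nat).
Implicit Types (x y a n : 'rV[R]_d) (A K e : set 'rV[R]_d).

(* The norm of the library on 'rV[R]_d is the sup norm: it induces the usual
   topology, but lengths and orthogonality have to be Euclidean. *)
Definition dotV x y : R := \sum_i x ord0 i * y ord0 i.

Definition edist x y : R := Num.sqrt (dotV (y - x) (y - x)).

Definition ediam A : \bar R :=
  ereal_sup (0%E |` [set (edist x y)%:E | x in A & y in A]).

Definition frontier A : set 'rV[R]_d := closure A `\` A°.

Definition volume A : R := fine (lebesgue_rV R d A).

(* Finite Boolean combinations of half-spaces. *)
Inductive polyhedral : set 'rV[R]_d -> Prop :=
| polyhedral_halfspace a (b : R) : polyhedral [set x | dotV a x < b]
| polyhedral_setC A : polyhedral A -> polyhedral (~` A)
| polyhedral_setI A B : polyhedral A -> polyhedral B -> polyhedral (A `&` B).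

Definition locally_halfspace K x a :=
  \forall y \near x, K y <-> dotV a (y - x) < 0.

(* The (d-1)-dimensional faces (edges if d = 2) of a polyhedral set K: the points of
   the hyperplane a.x = b near which K is the half-space a.x < b form relatively open
   subsets of that hyperplane, whose connected components are the relative interiors
   of the faces of K with outward normal direction a. *)
Definition facet_points K a (b : R) : set 'rV[R]_d :=
  [set x | dotV a x = b /\ locally_halfspace K x a].

Definition is_face K e := exists a (b : R) x,
  [/\ a != 0, facet_points K a b x &
      e = closure (connected_component (facet_points K a b) x)].

End geometry.

(* k-dimensional Hausdorff measure, normalised by the volume of the k-dimensional
   Euclidean ball of diameter 1, so that it extends the k-dimensional area. *)
Definition hausdorff_const (R : realType) (k : nat) : R :=
  volume [set v : 'rV[R]_k | edist 0 v <= 1] / 2 ^+ k.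

Definition hausdorff_pre (R : realType) (d k : nat) (delta : R)
    (A : set 'rV[R]_d) : \bar R :=
  ereal_inf [set (\sum_(0 <= i <oo) (hausdorff_const R k)%:E * ediam (U i) ^+ k)%E
            | U in [set U : (set 'rV[R]_d)^nat |
                A `<=` \bigcup_i U i /\ forall i, (ediam (U i) <= delta%:E)%E]].

Definition hausdorff (R : realType) (d k : nat) (A : set 'rV[R]_d) : \bar R :=
  ereal_sup [set hausdorff_pre k delta A | delta in [set delta : R | 0 < delta]].

Section faces.
Context (R : realType) (d : nat).
Implicit Types (K e : set 'rV[R]_d) (n : 'rV[R]_d).

Definition area e : R := fine (hausdorff d.-1 e).

Definition unit_normal e n :=
  dotV n n = 1 /\ forall x y, e x -> e y -> dotV n (y - x) = 0.

(* Outwardness is required almost everywhere on e only: isolated vertices or edges of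
   other cells may touch the relative interior of e. *)
Definition outward_unit_normal K e n := unit_normal e n /\
  exists2 N : set 'rV[R]_d, hausdorff d.-1 N = 0%E &
    forall x, (e `\` N) x -> locally_halfspace K x n.

Context (Omega : set 'rV[R]_d) (I : Type) (cell : I -> set 'rV[R]_d).

Definition boundary_faces : set (set 'rV[R]_d) :=
  [set e | e `<=` frontier Omega /\ exists K : I, is_face (cell K) e].

(* e = K1|K2 *)
Definition separates (K1 K2 : I) e :=
  [/\ K1 <> K2, e = closure (cell K1) `&` closure (cell K2) & hausdorff d.-1 e <> 0%E].

Definition internal_faces : set (set 'rV[R]_d) :=
  [set e | exists K1 K2 : I, separates K1 K2 e].

End faces.

(* Cells and faces are enumerated without repetition (two cells with different indices
   are disjoint and non-empty, hence different), so that R^#T and R^#E are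
   'rV[R]_ncells and 'rV[R]_nfaces. *)
Record mesh (R : realType) (d : nat) (Omega : set 'rV[R]_d) := Mesh {
  ncells : nat;
  cell : 'I_ncells -> set 'rV[R]_d;
  cell_neq0 : forall K, cell K !=set0;
  cell_open : forall K, open (cell K);
  cell_polyhedral : forall K, polyhedral (cell K);
  cells_cover : \bigcup_K closure (cell K) = closure Omega;
  cells_disjoint : forall K1 K2, cell K1 `&` cell K2 = set0 \/ K1 = K2;
  nfaces : nat;
  face : 'I_nfaces -> set 'rV[R]_d;
  face_inj : injective face;
  faces_range : range face = boundary_faces Omega cell `|` internal_faces cell;
  boundary_faces_cover : \bigcup_(e in boundary_faces Omega cell) e = frontier Omega;
  boundary_face_unique : forall e, boundary_faces Omega cell e ->
    exists! K, e `<=` closure (cell K) `&` frontier Omega;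
  internal_face_unique : forall e K1 K2 L1 L2,
    separates cell K1 K2 e -> separates cell L1 L2 e ->
    K1 = L1 /\ K2 = L2 \/ K1 = L2 /\ K2 = L1;
  faces_cover : \bigcup_e face e = \bigcup_K frontier (cell K);
  faces_overlap : forall e1 e2, e1 <> e2 ->
    face e1 `&` face e2 = set0 \/ hausdorff d.-1 (face e1 `&` face e2) = 0%E;
  (* outer_normal K e is n_{K,e} and is only meaningful if e is on the boundary of K *)
  outer_normal : 'I_ncells -> 'I_nfaces -> 'rV[R]_d;
  outer_normalP : forall K e, face e `<=` frontier (cell K) ->
    outward_unit_normal (cell K) (face e) (outer_normal K e);
  (* the intrinsic orientation of the faces *)
  normal : 'I_nfaces -> 'rV[R]_d;
  normal_unit : forall e, unit_normal (face e) (normal e);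
  normalE : forall K e, face e `<=` frontier (cell K) ->
    normal e = outer_normal K e \/ normal e = - outer_normal K e }.

Arguments cell {R d Omega} m K : rename.
Arguments face {R d Omega} m e : rename.
Arguments outer_normal {R d Omega} m K e : rename.
Arguments normal {R d Omega} m e : rename.

Section finite_volumes.
Context (R : realType) (d : nat) (Omega : set 'rV[R]_d) (T : mesh Omega).

Definition internal_between (e : 'I_(nfaces T)) (K1 K2 : 'I_(ncells T)) :=
  separates (cell T) K1 K2 (face T e).

(* e = K|dOmega *)
Definition boundary_of (e : 'I_(nfaces T)) (K : 'I_(ncells T)) :=
  boundary_faces Omega (cell T) (face T e) /\
  face T e `<=` closure (cell T K) `&` frontier Omega.

(* xK are the cell centres; the value xE e matters only if e is a boundary face. *)
Context (xK : 'I_(ncells T) -> 'rV[R]_d) (xE : 'I_(nfaces T) -> 'rV[R]_d).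

Definition orthogonal_segment (x y : 'rV[R]_d) (e : set 'rV[R]_d) :=
  forall z w, e z -> e w -> dotV (y - x) (w - z) = 0.

Definition admissible :=
  [/\ forall K, cell T K (xK K),
      forall e, boundary_faces Omega (cell T) (face T e) -> face T e (xE e),
      forall e K1 K2, internal_between e K1 K2 ->
        orthogonal_segment (xK K1) (xK K2) (face T e) &
      forall e K, boundary_of e K -> orthogonal_segment (xE e) (xK K) (face T e)].

(* In face_dist and flux, the pair (K1, K2) with e = K1|K2 is unique up to order and
   the result does not depend on the order; no face is both internal and on the
   boundary, and the last branches are never reached. *)
Definition face_dist (e : 'I_(nfaces T)) : R :=
  if [pick p | `[< internal_between e p.1 p.2 >]] is Some (K1, K2) then
    edist (xK K1) (xK K2)
  else if [pick K | `[< boundary_of e K >]] is Some K then edist (xK K) (xE e)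
  else 0.

Definition flux (u : 'rV[R]_(ncells T)) : 'rV[R]_(nfaces T) :=
  \row_e
    if [pick p | `[< internal_between e p.1 p.2 >]] is Some (K1, K2) then
      (u ord0 K2 - u ord0 K1) / face_dist e
        * dotV (outer_normal T K1 e) (normal T e)
    else if [pick K | `[< boundary_of e K >]] is Some K then
      - (u ord0 K / face_dist e) * dotV (outer_normal T K e) (normal T e)
    else 0.

Definition div_h (p : 'rV[R]_(nfaces T)) : 'rV[R]_(ncells T) :=
  \row_K ((volume (cell T K))^-1 *
    \sum_(e | `[< face T e `<=` frontier (cell T K) >])
       p ord0 e * area (face T e) * dotV (normal T e) (outer_normal T K e)).

Definition laplace_h (u : 'rV[R]_(ncells T)) : 'rV[R]_(ncells T) :=
  div_h (flux u).

Definition pi2 (f : 'rV[R]_d -> R) : 'rV[R]_(ncells T) :=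
  \row_K ((volume (cell T K))^-1 *
    \int[lebesgue_rV R d]_(x in (cell T K : set (borel R d))) f x).

Definition P_h (f : 'rV[R]_d -> R) (u : 'rV[R]_(ncells T)) : 'rV[R]_(ncells T) :=
  - laplace_h u - pi2 f.

Definition L_h (f : 'rV[R]_d -> R) (u : 'rV[R]_(ncells T)) : R :=
  2^-1 * (\sum_e flux u ord0 e ^+ 2 * area (face T e) * face_dist e)
  - \sum_K pi2 f ord0 K * u ord0 K * volume (cell T K).

End finite_volumes.

(* P u = 0 and DL(u)(v) = 0 for all v have the same solutions u; is_derive u v L 0
   says that the limit defining DL(u)(v) exists and is 0. *)
Definition coherent (R : realType) (n : nat)
    (P : 'rV[R]_n -> 'rV[R]_n) (L : 'rV[R]_n -> R) :=
  [set u | P u = 0] = [set u | forall v, is_derive u v L 0].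

(* Main.v *)
(* Discrete integration by parts: for every p and v, the sum over the cells of
   |K| (div_K p) v_K is minus the sum over the faces of p_e (F_e v) |e| d_e. Hence the
   differential of L_h at u in the direction v is the sum of |K| (P_h u)_K v_K, and it
   vanishes for all v iff P_h u = 0, as the volumes |K| are positive.
   The identity holds face by face, provided that an internal face K1|K2 lies on the
   boundary of no third cell and has opposite outer normals on both sides. Disjoint
   cells that are locally half-spaces at a common point have opposite normals there,
   so three pairwise disjoint ones cannot exist; such a point is found on the face
   because the exceptional sets of the outer normals are Hausdorff-null. *)

Require Import Defs.
From mathcomp Require Import all_boot all_order all_algebra.
From mathcomp Require Import all_classical all_reals all_analysis.
From mathcomp Require Import ring lra.
Import Order.TTheory GRing.Theory Num.Theory.
Import numFieldNormedType.Exports.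
Local Open Scope classical_set_scope.
Local Open Scope ring_scope.

(** * Euclidean geometry: scalar products, frontiers and local half-spaces *)

Section euclidean.
Context {R : realType} {d : nat}.
Implicit Types (x y z a n m : 'rV[R]_d) (A B K e : set 'rV[R]_d).

Lemma dotVC x y : dotV x y = dotV y x.
Proof. by apply: eq_bigr => i _; rewrite mulrC. Qed.

Lemma dotVDr x y z : dotV x (y + z) = dotV x y + dotV x z.
Proof. by rewrite -big_split; apply: eq_bigr => i _; rewrite mxE mulrDr. Qed.

Lemma dotVZr x y (t : R) : dotV x (t *: y) = t * dotV x y.
Proof. by rewrite mulr_sumr; apply: eq_bigr => i _; rewrite mxE mulrCA. Qed.

Lemma dotVNr x y : dotV x (- y) = - dotV x y.
Proof. by rewrite -scaleN1r dotVZr mulN1r. Qed.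

Lemma dotV0r x : dotV x 0 = 0.
Proof. by rewrite -(scale0r 0) dotVZr mul0r. Qed.

Lemma dotV_gt0 x : x != 0 -> 0 < dotV x x.
Proof.
move=> x0; rewrite lt_def sumr_ge0 ?andbT => [|i _]; last by rewrite -expr2 sqr_ge0.
apply: contra x0; rewrite psumr_eq0 => [/allP h|i _]; last by rewrite -expr2 sqr_ge0.
apply/eqP/rowP => i; rewrite mxE.
by have := h i (mem_index_enum i); rewrite /= -expr2 sqrf_eq0 => /eqP.
Qed.

Lemma edist_neq0 x y : x <> y -> Defs.edist x y != 0.
Proof.
by move=> xy; rewrite gt_eqF// sqrtr_gt0 dotV_gt0// subr_eq0 eq_sym; apply/eqP.
Qed.

(** The point [t *: s + x] tends to [x] as [t] tends to 0, so a property valid near [x] holds there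
    for some [t > 0]. *)
Lemma near_along x s (P : set 'rV[R]_d) :
  (\forall y \near x, P y) -> exists2 t : R, 0 < t & P (t *: s + x).
Proof.
move=> Px.
have c : (t *: s + x) @[t --> (0 : R)] --> x.
  have -> : nbhs x = nbhs (0 *: s + x) by rewrite scale0r add0r.
  by apply: cvgD; [apply: cvgZr_tmp; exact: cvg_id|exact: cvg_cst].
have /nbhs_ballP[e /= e0 eP] := c _ Px.
exists (e / 2); first by rewrite divr_gt0.
apply: eP; rewrite /ball /= sub0r normrN gtr0_norm ?divr_gt0//.
by rewrite ltr_pdivrMr// ltr_pMr// ltr1n.
Qed.

(** Moving from [x] along [- a] enters [K] in every neighbourhood, while [x] itself fails the strict
    inequality. *)
Lemma locally_halfspace_frontier K x a :
  a != 0 -> locally_halfspace K x a -> frontier K x.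
Proof.
move=> a0 Kx; split.
  move=> B Bx; have [t t0 [Kt Bt]] := near_along x (- a) _ (filterI Kx Bx).
  exists (t *: - a + x); split=> //; apply/Kt.
  by rewrite addrK dotVZr dotVNr mulrN oppr_lt0 mulr_gt0// dotV_gt0.
move=> /interior_subset; rewrite (nbhs_singleton Kx) subrr dotV0r.
by rewrite ltxx.
Qed.

Lemma closed_frontier K : closed (frontier K).
Proof.
apply: closedI; first exact: closed_closure.
by apply: open_closedC; exact: open_interior.
Qed.

(** Facet points are frontier points, and the frontier is closed, so taking the closure of a
    component stays inside it. *)
Lemma is_face_frontier K e : is_face K e -> e `<=` frontier K.
Proof.
move=> [a [b [x [a0 _ ->]]]].
rewrite [X in _ `<=` X](closure_id _).1; last exact: closed_frontier.
apply: closureS => y /connected_component_sub[_].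
exact: locally_halfspace_frontier.
Qed.

Lemma frontier_closure K : frontier K `<=` closure K.
Proof. by move=> x []. Qed.

Lemma disjoint_closure A B : open B -> A `&` B = set0 -> closure A `&` B = set0.
Proof.
move=> oB AB; apply/seteqP; split=> // x [Ax Bx].
by have := Ax B (open_nbhs_nbhs (conj oB Bx)); rewrite AB => -[].
Qed.

(* Two open half-spaces with a common boundary point x and unit normals n and m both
   contain x - t (n + m) unless n + m = 0. *)
Lemma locally_halfspace_opp A B x n m : A `&` B = set0 ->
  dotV n n = 1 -> dotV m m = 1 ->
  locally_halfspace A x n -> locally_halfspace B x m -> m = - n.
Proof.
move=> AB nn mm Ax Bx; apply/eqP; rewrite -addr_eq0; apply/negPn/negP => nm0.
have [t t0 [At Bt]] := near_along x (- (m + n)) _ (filterI Ax Bx).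
have : 0 < dotV (m + n) (m + n) by exact: dotV_gt0.
rewrite dotVDr ![dotV (m + n) _]dotVC !dotVDr nn mm [dotV n m]dotVC => mn.
have : (A `&` B) (t *: - (m + n) + x); last by rewrite AB.
(* Both inequalities reduce to [0 < 1 + dotV n m]; [mn] says that twice this number is positive. *)
split; [apply/At|apply/Bt]; rewrite addrK dotVZr dotVNr dotVDr ?nn ?mm mulrN;
  rewrite oppr_lt0 mulr_gt0//; [rewrite dotVC|]; lra.
Qed.

End euclidean.

(** * Hausdorff-null sets *)

Section hausdorff_null.
Context {R : realType} {d : nat}.
Implicit Types (A B C : set 'rV[R]_d) (k : nat).
Local Open Scope ereal_scope.

Lemma ediam_ge0 A : 0 <= ediam A.
Proof. by apply: ereal_sup_ubound; left. Qed.

Lemma hausdorff_term_ge0 k A : 0 <= (hausdorff_const R k)%:E * ediam A ^+ k.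
Proof.
rewrite mule_ge0 ?expe_ge0 ?ediam_ge0// lee_fin divr_ge0 ?exprn_ge0//.
exact: fine_ge0.
Qed.

Lemma hausdorff_pre_ge0 k (delta : R) A : 0 <= hausdorff_pre k delta A.
Proof.
apply: le_ereal_inf_tmp => _ [U _ <-]; apply: nneseries_ge0 => i _ _.
exact: hausdorff_term_ge0.
Qed.

(** The first [2n] terms of [w] add up to the [n]-th partial sums of [u] and [v], and dominate the
    first [n] terms of [w]. *)
Lemma nneseries_interleave (u v w : (\bar R)^nat) :
  (forall i, 0 <= u i) -> (forall i, 0 <= v i) ->
  (forall i, w i.*2 = u i) -> (forall i, w i.*2.+1 = v i) ->
  \sum_(0 <= i <oo) w i <= \sum_(0 <= i <oo) u i + \sum_(0 <= i <oo) v i.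
Proof.
move=> u0 v0 wu wv.
have w0 i : 0 <= w i.
  by rewrite -(odd_double_half i); case: odd; rewrite ?wv// add0n wu.
have w2 n : \sum_(0 <= i < n.*2) w i =
    \sum_(0 <= i < n) u i + \sum_(0 <= i < n) v i.
  elim: n => [|n IH]; first by rewrite !big_geq// adde0.
  by rewrite doubleS !big_nat_recr//= IH wu wv -addeA addeACA.
apply: lime_le; first by apply: is_cvg_nneseries => i _ _.
apply: nearW => n; apply: (@le_trans _ _ (\sum_(0 <= i < n.*2) w i)).
  by apply: lee_sum_nneg_natr => //; rewrite -addnn leq_addr.
by rewrite w2; apply: leeD; apply: nneseries_lim_ge.
Qed.

(** At each scale [delta], a cover of [A] and one of [B], each with sum below [eps / 2], interleave
    to a cover of [C] with sum at most [eps]. *)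
Lemma hausdorff_null_subU k A B C : C `<=` A `|` B ->
  hausdorff k A = 0 -> hausdorff k B = 0 -> hausdorff k C = 0.
Proof.
move=> CAB A0 B0; apply/eqP; rewrite eq_le; apply/andP; split; last first.
  apply: le_trans (hausdorff_pre_ge0 k 1 C) _.
  by apply: ereal_sup_ubound; exists 1%R => //=.
(* Each pre-measure is at most the Hausdorff measure, here 0, so its infimum is approached by a
   cover with sum below [eps]. *)
have cover D (delta eps : R) : hausdorff k D = 0 -> (0 < delta)%R -> (0 < eps)%R ->
    exists2 U : (set 'rV[R]_d)^nat,
      D `<=` \bigcup_i U i /\ (forall i, ediam (U i) <= delta%:E) &
      \sum_(0 <= i <oo) (hausdorff_const R k)%:E * ediam (U i) ^+ k < eps%:E.
  move=> D0 delta0 eps0.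
  have : hausdorff_pre k delta D < eps%:E.
    apply: (@le_lt_trans _ _ 0); last by rewrite lte_fin.
    by rewrite -D0; apply: ereal_sup_ubound; exists delta.
  by move=> /ereal_inf_lt[_ [U HU <-]] h; exists U.
apply: ge_ereal_sup => _ [delta /= delta0 <-].
apply/lee_addgt0Pr => eps eps0; rewrite add0e.
have eps20 : (0 < eps / 2)%R by rewrite divr_gt0.
have [U [AU Ud] Us] := cover _ _ _ A0 delta0 eps20.
have [V [BV Vd] Vs] := cover _ _ _ B0 delta0 eps20.
pose W i := if odd i then V i./2 else U i./2.
have WU i : W i.*2 = U i by rewrite /W odd_double doubleK.
have WV i : W i.*2.+1 = V i by rewrite /W /= odd_double /= uphalf_double.
apply: (@le_trans _ _
    (\sum_(0 <= i <oo) (hausdorff_const R k)%:E * ediam (W i) ^+ k)).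
  apply: ereal_inf_lbound; exists W => //=; split.
    move=> x /CAB[/AU|/BV] [i _ Hi]; first by exists i.*2; rewrite ?WU.
    by exists i.*2.+1; rewrite ?WV.
  by move=> i; rewrite /W; case: ifP.
rewrite [in leRHS](splitr eps) EFinD.
apply: le_trans (leeD (ltW Us) (ltW Vs)).
apply: nneseries_interleave => i; try exact: hausdorff_term_ge0.
  by rewrite WU.
by rewrite WV.
Qed.

End hausdorff_null.

(** * Positivity of volumes, derivatives of quadratic functions, bounded closures *)

Lemma volume_gt0 {R : realType} {d : nat} (A : set 'rV[R]_d) :
  A !=set0 -> open A -> bounded_set A -> 0 < volume A.
Proof.
move=> [x Ax] oA [M [_ MA]].
have mA : measurable (A : set (borel R d)) by exact: sub_sigma_algebra.
have mbox (a b : 'I_d -> R) :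
    measurable ([set v : 'rV_d | forall j, a j < v ord0 j < b j] : set (borel R d)).
  by apply: sub_sigma_algebra; exact: open_box.
have /nbhs_ballP[e /= e0 eA] := open_nbhs_nbhs (conj oA Ax).
(* [fine] sends infinity to 0, so the measure must be shown both positive and finite: a box inside
   [A], then a box around it. *)
apply: fine_gt0; apply/andP; split.
  apply: (@lt_le_trans _ _ (lebesgue_rV R d
      [set v : 'rV_d | forall j, x ord0 j - e < v ord0 j < x ord0 j + e])).
    rewrite (lebesgue_rV_box (a := fun j => x ord0 j - e)
      (b := fun j => x ord0 j + e)); last by move=> j; lra.
    by rewrite lte_fin prodr_gt0// => j _; lra.
  apply: le_measure; [rewrite inE|by rewrite inE|].
    exact: (mbox (fun j => x ord0 j - e) (fun j => x ord0 j + e)).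
  (* Balls of the sup norm are boxes. *)
  move=> v /= h; apply: eA; split=> // i j; rewrite (ord1 i).
  have := h j; rewrite /ball /= ltr_norml; lra.
(* [bounded_set] bounds norms only by numbers strictly above [M]; the box uses [N + 1] because its
   inequalities are strict. *)
pose N := `|M| + 1.
have N0 : 0 <= N by rewrite addr_ge0.
apply: (@le_lt_trans _ _ (lebesgue_rV R d
    [set v : 'rV_d | forall j, - (N + 1) < v ord0 j < N + 1])).
  apply: le_measure; [by rewrite inE|rewrite inE|].
    exact: (mbox (fun=> - (N + 1)) (fun=> N + 1)).
  move=> v /= Av j; rewrite -ltr_norml.
  have vN : `|v| <= N.
    by apply: MA Av; rewrite (le_lt_trans (ler_norm M))// ltrDl.
  apply: (@le_lt_trans _ _ `|v|); last by rewrite (le_lt_trans vN)// ltrDl.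
  rewrite /Num.norm /= mx_normrE.
  by apply: (le_bigmax _ (fun i => `|v i.1 i.2|) (ord0, j)).
rewrite (lebesgue_rV_box (a := fun=> - (N + 1)) (b := fun=> N + 1)) ?ltry//.
by move=> j; lra.
Qed.

(** For [h != 0] the difference quotient is exactly [b + h * q]. *)
Lemma is_derive_quadratic {R : realType} {n : nat} (L : 'rV[R]_n -> R)
    (u v : 'rV[R]_n) (b q : R) :
  (forall h, L (h *: v + u) = L u + h * b + h ^+ 2 * q) -> is_derive u v L b.
Proof.
move=> Lq.
have c : h^-1 *: ((L \o shift u) (h *: v) - L u) @[h --> (0 : R)^'] --> b.
  apply: (@cvg_trans _ ((b + h * q) @[h --> (0 : R)^'])).
    apply: near_eq_cvg; near=> h.
    have h0 : h != 0 by near: h; exact: nbhs_dnbhs_neq.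
    rewrite /= Lq -[_ *: _]/(_ * _); field.
    exact: h0.
  have -> : nbhs b = nbhs (b + 0 * q) by rewrite mul0r addr0.
  apply: cvgD; first exact: cvg_cst.
  by apply: cvgMr_tmp; apply: cvg_within_filter; exact: cvg_id.
apply: DeriveDef; first by apply/cvg_ex; exists b.
exact: cvg_lim c.
Unshelve. all: by end_near.
Qed.

(** A closed ball containing [A] contains its closure. This bounds the cells, which are located only
    in the closure of [Omega]. *)
Lemma bounded_closure {R : realType} {V : normedModType R} (A : set V) :
  bounded_set A -> bounded_set (closure A).
Proof.
move=> [M [Mr MA]]; exists M; split=> // N MN.
have cN : closed [set x : V | `|x| <= N].
  apply: (@preimage_closed _ _ (fun x : V => `|x|) [set r | r <= N]).
    by move=> x _; exact: norm_continuous.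
  exact: closed_le.
suff : closure A `<=` [set x : V | `|x| <= N] by [].
by rewrite ((closure_id _).1 cN); apply: closureS; exact: MA.
Qed.

(** * Cells around a face, and discrete integration by parts *)

Section green.
Context {R : realType} {d : nat} {Omega : set 'rV[R]_d} (T : mesh Omega).
Context (xK : 'I_(ncells T) -> 'rV[R]_d) (xE : 'I_(nfaces T) -> 'rV[R]_d).
Implicit Types (e : 'I_(nfaces T)) (K : 'I_(ncells T)) (u v : 'rV[R]_(ncells T)).

Lemma cells_disj K1 K2 : K1 <> K2 -> cell T K1 `&` cell T K2 = set0.
Proof. by case: (cells_disjoint K1 K2). Qed.

Lemma cell_volume_gt0 K : bounded_set Omega -> 0 < volume (cell T K).
Proof.
move=> bO; apply: volume_gt0; [exact: cell_neq0|exact: cell_open|].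
have [M [Mr MO]] := bounded_closure _ bO.
exists M; split=> // N MN x Kx; apply: (MO N MN).
by rewrite -(cells_cover T); exists K => //; exact: subset_closure.
Qed.

Lemma face_opposite_normals e K1 K2 : K1 <> K2 ->
  hausdorff d.-1 (face T e) <> 0%E ->
  face T e `<=` frontier (cell T K1) -> face T e `<=` frontier (cell T K2) ->
  outer_normal T K2 e = - outer_normal T K1 e.
Proof.
move=> K12 e0 /outer_normalP[[n1 _] [N1 N10 h1]] /outer_normalP[[n2 _] [N2 N20 h2]].
(* Otherwise the face would be covered by two null sets, hence null. *)
have [x [ex Nx]] : (face T e `\` (N1 `|` N2)) !=set0.
  apply/set0P/negP => /eqP /subsets_disjoint/(hausdorff_null_subU _ _ _ _).
  by move=> /(_ _ N10 N20).
apply: (locally_halfspace_opp (cell T K1) (cell T K2) x) => //.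
- exact: cells_disj.
- by apply: h1; split=> // ?; apply: Nx; left.
- by apply: h2; split=> // ?; apply: Nx; right.
Qed.

Lemma separates_sym e K1 K2 :
  internal_between e K1 K2 -> internal_between e K2 K1.
Proof. by move=> [K12 eE e0]; split; [exact: nesym|rewrite setIC|]. Qed.

(** A point of the face inside [K1] would lie in the closure of [K2], which the open disjoint cell
    [K1] cannot meet. *)
Lemma internal_frontier e K1 K2 :
  internal_between e K1 K2 -> face T e `<=` frontier (cell T K1).
Proof.
move=> [K12 -> _] x [c1 c2]; split=> //.
rewrite (interior_id _).1; last exact: cell_open.
move=> K1x; have : (closure (cell T K2) `&` cell T K1) x by [].
by rewrite disjoint_closure//; [exact: cell_open|exact/cells_disj/nesym].
Qed.

Lemma internal_cells {e K1 K2} (e12 : internal_between e K1 K2) K :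
  face T e `<=` frontier (cell T K) <-> K = K1 \/ K = K2.
Proof.
have [K12 _ e0] := e12.
have f1 := internal_frontier _ _ _ e12.
have f2 := internal_frontier _ _ _ (separates_sym _ _ _ e12).
split=> [fK|[]-> //].
have [|KK1] := eqVneq K K1; [by left|].
have [|KK2] := eqVneq K K2; [by right|].
have n1 := face_opposite_normals _ _ _ (elimN eqP KK1) e0 fK f1.
have n2 := face_opposite_normals _ _ _ (elimN eqP KK2) e0 fK f2.
have n12 := face_opposite_normals _ _ _ K12 e0 f1 f2.
have [[nn _] _] := outer_normalP fK.
(* Three pairwise opposite normals all vanish, contradicting unit length. *)
have n0 : outer_normal T K e = 0.
  apply/rowP => i; have /rowP/(_ i) := n12; rewrite n1 n2 !mxE; lra.
by move: nn; rewrite n0 dotV0r => /esym/eqP; rewrite oner_eq0.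
Qed.

Lemma face_boundary {e} : (forall p, `[< internal_between e p.1 p.2 >] = false) ->
  boundary_faces Omega (cell T) (face T e).
Proof.
move=> none; have : range (face T) (face T e) by exists e.
rewrite faces_range => -[//|[K1 [K2 e12]]].
by have /asboolP := none (K1, K2).
Qed.

(** A cell with [e] on its frontier has [e] in its closure, so it is [K] by uniqueness. Conversely
    [e] is a face of some cell, has to lie on its frontier, and that cell is therefore [K]. *)
Lemma boundary_cells {e K} (eK : boundary_of e K) K' :
  face T e `<=` frontier (cell T K') <-> K' = K.
Proof.
have [be eO] := eK.
have [L [_ LU]] := boundary_face_unique be.
have KL := LU _ eO.
have sub M : face T e `<=` frontier (cell T M) -> M = K.
  move=> fM; rewrite -KL; apply/esym/LU => x ex.
  by split; [exact/frontier_closure/fM|have [] := eO x ex].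
split=> [|->]; first exact: sub.
have [_ [M /is_face_frontier fM]] := be.
by rewrite -(sub M fM).
Qed.

(** Centres of disjoint cells differ, and [xE e] lies on the frontier of an open cell containing
    [xK K]. The division by [face_dist] in [flux] can thus be cancelled. *)
Lemma face_dist_neq0 : admissible xK xE -> forall e, face_dist xK xE e != 0.
Proof.
move=> [xKK xEe _ _] e; rewrite /face_dist.
case: pickP => [[K1 K2] /asboolP[/= K12 _ _]|none].
  apply: edist_neq0 => x12.
  have : (cell T K1 `&` cell T K2) (xK K1) by split=> //; rewrite x12.
  by rewrite cells_disj.
have be := face_boundary none.
case: pickP => [K /asboolP eK|noK].
  apply: edist_neq0 => xKe.
  have [_] := (boundary_cells eK K).2 erefl _ (xEe e be).
  rewrite (interior_id _).1 -?xKe; last exact: cell_open.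
  by apply; exact: xKK.
have [K [eK _]] := boundary_face_unique be.
by have /asboolP := noK K; case.
Qed.

(** This is integration by parts on one face: opposite normals turn the two terms of an internal
    face into a jump, and a boundary face has a single term, the value outside being 0. *)
Lemma sum_jump_flux : admissible xK xE -> forall v e,
  \sum_(K | `[< face T e `<=` frontier (cell T K) >])
    v ord0 K * dotV (normal T e) (outer_normal T K e) =
  - (face_dist xK xE e * flux xK xE v ord0 e).
Proof.
move=> adm v e; have de := face_dist_neq0 adm e.
rewrite mxE; case: pickP => [[K1 K2] /asboolP/= e12|none].
  have [K12 _ e0] := e12.
  have f := internal_cells e12.
  rewrite (bigD1 K1)/=; last by apply/asboolP/f; left.
  rewrite (bigD1 K2)/=; last first.
    by apply/andP; split; [apply/asboolP/f; right|apply/eqP/nesym].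
  rewrite big1 ?addr0; last first.
    by move=> K /andP[/andP[/asboolP/f[->|->]]]; rewrite eqxx.
  rewrite (face_opposite_normals e K1 K2)//; [|by apply/f; left|by apply/f; right].
  rewrite dotVNr [dotV (normal T e) _]dotVC; field.
  exact: de.
(* The default branch of [flux] is unreachable: a face that is not internal is a boundary face and
   has a cell. *)
case: pickP => [K /asboolP eK|noK]; last first.
  have be := face_boundary none.
  have [K [eK _]] := boundary_face_unique be.
  by have /asboolP := noK K; case.
rewrite (big_pred1 K) => [|K' /=].
  rewrite dotVC; field; exact: de.
by apply/asboolP/eqP; rewrite (boundary_cells eK).
Qed.

(** The volumes cancel the prefactor of [div_h]; after exchanging the sums over cells and faces,
    [sum_jump_flux] applies to each face. *)
Lemma discrete_green : bounded_set Omega -> admissible xK xE ->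
  forall (p : 'rV[R]_(nfaces T)) v,
  \sum_K volume (cell T K) * div_h p ord0 K * v ord0 K =
  - \sum_e p ord0 e * flux xK xE v ord0 e * area (face T e) * face_dist xK xE e.
Proof.
move=> bO adm p v.
under eq_bigr => K _.
  rewrite mxE mulVKf ?gt_eqF ?cell_volume_gt0// mulr_suml big_mkcond.
  over.
rewrite exchange_big -sumrN; apply: eq_bigr => e _ /=.
rewrite -big_mkcond /= [RHS](_ : _ = p ord0 e * area (face T e) *
    - (face_dist xK xE e * flux xK xE v ord0 e)); last by ring.
rewrite -sum_jump_flux// mulr_sumr; apply: eq_bigr => K _; ring.
Qed.

(** * The differential of [L_h] *)

Lemma flux_linear u v (h : R) e :
  flux xK xE (h *: v + u) ord0 e =
  h * flux xK xE v ord0 e + flux xK xE u ord0 e.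
Proof.
rewrite !mxE; case: pickP => [[K1 K2] _|_]; first by rewrite !mxE; ring.
by case: pickP => [K _|_]; rewrite ?mxE; ring.
Qed.

Lemma is_derive_L_h : bounded_set Omega -> admissible xK xE -> forall f u v,
  is_derive u v (L_h xK xE f)
    (\sum_K volume (cell T K) * P_h xK xE f u ord0 K * v ord0 K).
Proof.
move=> bO adm f u v.
(* [discrete_green] with [p] the flux of [u] gives the form of the derivative that appears when the
   energy is expanded. *)
have -> : \sum_K volume (cell T K) * P_h xK xE f u ord0 K * v ord0 K =
    \sum_e flux xK xE u ord0 e * flux xK xE v ord0 e
      * area (face T e) * face_dist xK xE e
    - \sum_K pi2 T f ord0 K * v ord0 K * volume (cell T K).
  rewrite -[X in X - _]opprK -discrete_green// -!sumrN -big_split /=.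
  apply: eq_bigr => K _.
  have -> : P_h xK xE f u ord0 K =
    - div_h (flux xK xE u) ord0 K - pi2 T f ord0 K by rewrite !mxE.
  ring.
(* Along the line through [u], [L_h] is a quadratic polynomial in [h] whose leading coefficient is
   the flux energy of [v]. *)
apply: (is_derive_quadratic _ _ _ _ (2^-1 * \sum_e flux xK xE v ord0 e ^+ 2
  * area (face T e) * face_dist xK xE e)) => h.
rewrite /L_h.
have -> : \sum_e flux xK xE (h *: v + u) ord0 e ^+ 2
      * area (face T e) * face_dist xK xE e =
    \sum_e flux xK xE u ord0 e ^+ 2 * area (face T e) * face_dist xK xE e
    + 2 * h * (\sum_e flux xK xE u ord0 e * flux xK xE v ord0 e
      * area (face T e) * face_dist xK xE e)
    + h ^+ 2 * (\sum_e flux xK xE v ord0 e ^+ 2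
      * area (face T e) * face_dist xK xE e).
  rewrite !mulr_sumr -!big_split /=; apply: eq_bigr => e _.
  by rewrite flux_linear; ring.
have -> : \sum_K pi2 T f ord0 K * (h *: v + u) ord0 K * volume (cell T K) =
    \sum_K pi2 T f ord0 K * u ord0 K * volume (cell T K)
    + h * \sum_K pi2 T f ord0 K * v ord0 K * volume (cell T K).
  rewrite mulr_sumr -big_split /=; apply: eq_bigr => K _.
  have -> : (h *: v + u) ord0 K = h * v ord0 K + u ord0 K by rewrite !mxE.
  ring.
by field.
Qed.

End green.

(** * Equality of the two solution sets *)

Theorem theorem3 (R : realType) (d : nat) (d23 : d = 2%N \/ d = 3%N)
    (Omega : set 'rV[R]_d) (Omega_neq0 : Omega !=set0) (Omega_open : open Omega)
    (Omega_connected : connected Omega) (Omega_bounded : bounded_set Omega)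
    (T : mesh Omega)
    (xK : 'I_(ncells T) -> 'rV[R]_d) (xE : 'I_(nfaces T) -> 'rV[R]_d)
    (xKE : admissible xK xE)
    (f : 'rV[R]_d -> R) (fL2 : (f \_ Omega) \in Lfun (lebesgue_rV R d) 2%:E) :
  coherent (P_h xK xE f) (L_h xK xE f).
Proof.
have dL := is_derive_L_h T xK xE Omega_bounded xKE f.
apply/seteqP; split=> u /= Pu.
  move=> v; have := dL u v.
  by rewrite Pu big1// => K _; rewrite mxE mulr0 mul0r.
apply/rowP => K; rewrite [RHS]mxE.
(* The variation supported on the cell [K] isolates the term [|K|] times the component of [P_h u] at
   [K]. *)
pose v : 'rV[R]_(ncells T) := delta_mx ord0 K.
have vE L : v ord0 L = (L == K)%:R by rewrite mxE.
(* The derivative is computed twice, by [dL] and by the assumption [Pu], and the two values are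
   equated. *)
have := @derive_val _ _ _ _ _ _ _ (dL u v).
rewrite (@derive_val _ _ _ _ _ _ _ (Pu v)) (bigD1 K)//= big1 => [|L LK].
  rewrite vE eqxx mulr1 addr0 => /esym/eqP.
  by rewrite mulf_eq0 gt_eqF ?cell_volume_gt0//= => /eqP.
by rewrite vE (negbTE LK) mulr0.
Qed.
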